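(* Let $\kappa$ be an infinite cardinal. (a) If $D$ is a uniform $\aleph_1$-complete ultrafilter on $\kappa$ and $(\lambda_1,\lambda_2)\in\mathscr C(D)$, then $\lambda_1=\lambda_2$. (b) If $D$ is a uniform ultrafilter on $\kappa$ and $(\lambda_1,\lambda_2)\in\mathscr C_{>2^\kappa}(D)$, then $\lambda_1=\lambda_2$.
   Context: A cut of a linear order $L$ is a pair $(J^1,J^2)$ where $J^1$ is an initial segment of $L$ and $J^2=L\setminus J^1$; its cofinality is $(\theta_1,\theta_2)$, where $\theta_1$ is the cofinality of $J^1$ and $\theta_2$ is the co-initiality of $J^2$ (the cofinality of $J^2$ with reversed order). A dense linear order (without endpoints) $J$ is $\mu$-saturated if for all $A,B\subseteq J$ with $|A|,|B|<\mu$ and every element of $A$ below every element of $B$, there is $x\in J$ with $a<x<b$ for all $a\in A$, $b\in B$ ($A$ or $B$ may be empty). For an ultrafilter $D$ on $\kappa$, $\mathscr C(D)$ is the class of all pairs $(\theta_1,\theta_2)$ of infinite regular cardinals such that $(\theta_1,\theta_2)$ is the cofinality of a cut in the ultrapower $J^\kappa/D$ for some (equivalently, any) $(\theta_1+\theta_2)^+$-saturated dense linear order $J$. $\mathscr C_{>\lambda}(D)$ is the class of all $(\theta_1,\theta_2)\in\mathscr C(D)$ with $\theta_1+\theta_2>\lambda$. An ultrafilter $D$ on $\kappa$ is uniform if every member of $D$ has cardinality $\kappa$, and $\aleph_1$-complete if it is closed under countable intersections. The result is in ZFC. *)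

(* Defs.v *)
From HB Require Import structures.
From mathcomp Require Import all_boot all_order generic_quotient.
From mathcomp Require Import boolp classical_sets cardinality filter.
From mathcomp Require wochoice.

Set Implicit Arguments.
Unset Strict Implicit.
Unset Printing Implicit Defensive.

Import Order.TTheory.
Local Open Scope classical_set_scope.
Local Open Scope card_scope.
Local Open Scope quotient_scope.
Local Open Scope order_scope.

(** A cardinal is presented by a type of that cardinality; equality, sums and
    successors of cardinals are only considered up to equipotence. *)

Definition card_lt T U (A : set T) (B : set U) : Prop :=
  A #<= B /\ ~ (B #<= A).

Definition is_succ_card (M T : Type) : Prop :=
  card_lt [set: T] [set: M] /\
  forall U : Type, card_lt [set: T] [set: U] -> [set: M] #<= [set: U].

Definition cofinal_in T (r : rel T) (A C : set T) : Prop :=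
  C `<=` A /\ forall a, A a -> exists2 c, C c & r a c.

(* [theta] is the least cardinality of an [r]-cofinal subset of [A]. *)
Definition has_cofinality T (r : rel T) (A : set T) (theta : Type) : Prop :=
  (exists2 C, cofinal_in r A C & C #= [set: theta]) /\
  forall C, cofinal_in r A C -> [set: theta] #<= C.

(* A well-order is isomorphic to a cardinal (an initial ordinal) iff all its
   proper initial segments have strictly smaller cardinality. *)
Definition initial_ordinal d (W : orderType d) : Prop :=
  wochoice.well_order (<=%O : rel W) /\
  forall x : W, card_lt [set y : W | y < x] [set: W].

(* cf(theta) = theta, where theta is identified with its initial ordinal. *)
Definition infinite_regular (theta : Type) : Prop :=
  infinite_set [set: theta] /\
  exists (d : Order.disp_t) (W : orderType d),
    [/\ initial_ordinal W, [set: W] #= [set: theta]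
      & has_cofinality (<=%O : rel W) [set: W] theta].

Definition is_cut d (L : orderType d) (J1 J2 : set L) : Prop :=
  (forall x y, J1 y -> x <= y -> J1 x) /\ J2 = ~` J1.

Definition cut_cofinality d (L : orderType d) (J1 J2 : set L)
    (theta1 theta2 : Type) : Prop :=
  has_cofinality (<=%O : rel L) J1 theta1 /\
  has_cofinality (>=%O : rel L) J2 theta2.

Definition dense_no_endpoints d (J : orderType d) : Prop :=
  [/\ forall x y : J, x < y -> exists z, x < z /\ z < y,
      forall x : J, exists y, y < x
    & forall x : J, exists y, x < y].

Definition saturated (mu : Type) d (J : orderType d) : Prop :=
  forall A B : set J,
    card_lt A [set: mu] -> card_lt B [set: mu] ->
    (forall a b, A a -> B b -> a < b) ->
    exists x, (forall a, A a -> a < x) /\ (forall b, B b -> x < b).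

Section Ultrapower.
Context (K : Type) (D : set_system K) (UD : UltraFilter D).
Context (d : Order.disp_t) (J : orderType d).
Implicit Types f g h : K -> J.

Definition ultra_eq f g : bool := `[< D [set i | f i = g i] >].

Lemma ultra_eq_refl : reflexive ultra_eq.
Proof. by move=> f; apply/asboolP; apply: filterS filterT => i _. Qed.

Lemma ultra_eq_sym : symmetric ultra_eq.
Proof.
by move=> f g; apply/asboolP/asboolP; apply: filterS => i /= ->.
Qed.

Lemma ultra_eq_trans : transitive ultra_eq.
Proof.
move=> g f h /asboolP fg /asboolP gh; apply/asboolP.
by apply: filterS (filterI fg gh) => i /= [-> ->].
Qed.

Canonical ultra_eq_equiv :=
  EquivRel ultra_eq ultra_eq_refl ultra_eq_sym ultra_eq_trans.

Definition ultrapower := {eq_quot ultra_eq_equiv}.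

HB.instance Definition _ := Choice.on ultrapower.
HB.instance Definition _ := Quotient.on ultrapower.

Definition ultra_le (x y : ultrapower) : bool :=
  `[< D [set i | repr x i <= repr y i] >].

Lemma ultra_reprP f : D [set i | repr (\pi_ultrapower f) i = f i].
Proof.
have /eqmodP/asboolP // :
  repr (\pi_ultrapower f) = f %[mod {eq_quot ultra_eq_equiv}] by exact: reprK.
Qed.

Lemma ultra_piP f g :
  (\pi_ultrapower f = \pi_ultrapower g) <-> D [set i | f i = g i].
Proof. by split=> [/eqmodP/asboolP|fg] //; apply/eqmodP/asboolP. Qed.

Lemma ultra_leP f g :
  ultra_le (\pi_ultrapower f) (\pi_ultrapower g) <-> D [set i | f i <= g i].
Proof.
have Df := ultra_reprP f; have Dg := ultra_reprP g.
split=> [/asboolP fg|fg]; last apply/asboolP.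
- by apply: filterS (filterI fg (filterI Df Dg)) => i /= [+ [<- <-]].
- by apply: filterS (filterI fg (filterI Df Dg)) => i /= [+ [-> ->]].
Qed.

Lemma ultra_le_refl : reflexive ultra_le.
Proof. by move=> x; apply/asboolP; apply: filterS filterT => i _ /=. Qed.

Lemma ultra_le_anti : antisymmetric ultra_le.
Proof.
move=> x y /andP[/asboolP xy /asboolP yx].
rewrite -[x]reprK -[y]reprK; apply/ultra_piP.
by apply: filterS (filterI xy yx) => i /= [xy' yx']; apply/le_anti/andP.
Qed.

Lemma ultra_le_trans : transitive ultra_le.
Proof.
move=> y x z /asboolP xy /asboolP yz; apply/asboolP.
by apply: filterS (filterI xy yz) => i /= [xy' yz']; apply: le_trans yz'.
Qed.

Lemma ultra_le_total : total ultra_le.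
Proof.
move=> x y; apply/orP.
have [xy|xy] := in_ultra_setVsetC [set i | repr x i <= repr y i] UD.
  by left; apply/asboolP.
right; apply/asboolP; apply: filterS xy => i /= /negP.
by rewrite -ltNge => /ltW.
Qed.

HB.instance Definition _ := Order.Le_isPOrder.Build d ultrapower
  ultra_le_refl ultra_le_anti ultra_le_trans.
HB.instance Definition _ :=
  Order.POrder_isTotal.Build d ultrapower ultra_le_total.

Lemma ultrapower_leP f g :
  (\pi_ultrapower f <= \pi_ultrapower g) <-> D [set i | f i <= g i].
Proof. exact: ultra_leP. Qed.

End Ultrapower.

Definition uniform_filter K (D : set_system K) : Prop :=
  forall A, D A -> A #= [set: K].

Definition aleph1_complete K (D : set_system K) : Prop :=
  forall S : set (set K), countable S -> S `<=` D -> D (\bigcap_(A in S) A).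

(* (theta1, theta2) \in C(D); [mu] is (theta1 + theta2)^+. *)
Definition cut_spectrum K (D : set_system K) (UD : UltraFilter D)
    (theta1 theta2 : Type) : Prop :=
  [/\ infinite_regular theta1, infinite_regular theta2
    & exists (mu : Type) (d : Order.disp_t) (J : orderType d),
        [/\ is_succ_card mu (theta1 + theta2)%type,
            dense_no_endpoints J, saturated mu J
          & exists J1 J2 : set (ultrapower UD J),
              is_cut J1 J2 /\ cut_cofinality J1 J2 theta1 theta2]].

(* The cardinal lambda is presented by the type [Lam]. *)
Definition cut_spectrum_above (Lam : Type) K (D : set_system K)
    (UD : UltraFilter D) (theta1 theta2 : Type) : Prop :=
  cut_spectrum UD theta1 theta2 /\
  card_lt [set: Lam] [set: (theta1 + theta2)%type].

(* Main.v *)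
Require Import Defs.
From mathcomp Require Import all_boot all_order generic_quotient.
From mathcomp Require Import boolp classical_sets functions cardinality filter.
From mathcomp Require wochoice.

(** Represent a cut of [J^K/D] of cofinality [(L1, L2)] by functions [K -> J],
    compared modulo [D].  Two facts drive the proof.

    First, saturation.  Let [s a : K -> J], for [a : I], be a family indexed by
    a type of size at most [L1 + L2], and [B i], for [i : K], sets of indices.
    Say that [B] separates the cut if between any [f] on its left and any [g]
    on its right there is a function [i |-> s (w i) i] with [w i] in [B i].
    If such functions are cofinal on the left, then they are coinitial on the
    right: given [g] on the right, saturation provides at each coordinate a
    point just above all the [s a i < g i] with [a] in [B i]; these points form
    a function that exceeds every section on the left, so it is on the right of
    the cut; hence some [v] of a fixed coinitial family lies below it, and by
    the choice of the points some [s a i] falls between [v i] and [g i].  A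
    separating [B] thus approaches the cut from both sides ([approached_flip],
    [separating_approached]).

    Second, descent ([separating_below]).  Well-order [I].  If [L1] and [L2]
    are not equipotent and [B] separates the cut, then for some [y] with [y i]
    in [B i] the set of predecessors of [y i] in [B i] still separates it.
    Indeed, say [L2] is not at most [L1], and approach the left side along [L1]
    by sections [w a].  If no [w a] can serve as [y], then each [a] gives a
    point on the right below which no section strictly under [w a] passes;
    these are at most [L1] many points, so there is a section [w'] on the right
    below all of them.  Modulo [D], every [w a] is then strictly under [w'],
    and [y = w'] works.

    Starting from a cofinal family of size [L1], descent yields functions [y]
    that strictly decrease modulo [D] in a well-order, and it remains to stop.
    If [D] is countably complete, the ultrapower of a well-order is well-founded
    ([power_cut_complete]).  If [L1] and [L2] exceed [2^K], close an initial [y]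
    under the descent step applied to diagonals [i |-> y_i i] of [K]-sequences
    already obtained; this gives at most [2^K] functions, so there are [f] and
    [g] on the two sides that detect failure of separation for all of them.
    Choosing at each [i] the least available [y_i i] above an index of a point
    between [f i] and [g i] gives a separating function to which the descent
    step cannot apply ([power_cut_large]).  Finally, if one of [L1], [L2] is at
    most [2^K], there are at most [2^K] sections of a cofinal family on that
    side, and by the first fact they are coinitial on the other side
    ([power_cut_small_side]). *)

Set Implicit Arguments.
Unset Strict Implicit.
Unset Printing Implicit Defensive.

Import Order.TTheory.
Local Open Scope classical_set_scope.
Local Open Scope card_scope.

(** * Cardinal arithmetic *)

Lemma card_leTTP T U :
  ([set: T] #<= [set: U]) <-> exists f : T -> U, injective f.
Proof.
split=> [|[f f_inj]]; last first.
  have [g] : $|{injfun [set: T] >-> [set: U]}|.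
    by apply/injfunPex; exists f => // x y _ _ /f_inj.
  exact: inj_card_le g.
elim/Ppointed: U => U.
  rewrite emptyE => /eqP T0.
  have noT (x : T) : False by have : [set: T] x := I; rewrite T0.
  by exists (fun x => match noT x with end) => x; have := noT x.
by move=> /pcard_injP[f fi]; exists f => x y; apply: fi; rewrite inE.
Qed.

(** A maximal partial bijection is total on one of the two sides. *)
Lemma inj_compare T U :
  (exists f : T -> U, injective f) \/ (exists f : U -> T, injective f).
Proof.
pose P (G : set (T * U)) := forall p q, G p -> G q -> (p.1 = q.1 <-> p.2 = q.2).
have [G [PG Gmax]] : exists G, P G /\ forall H, G `<` H -> ~ P H.
  apply: Zorn_bigcup => F FP Ftot p q [X FX Xp] [Y FY Yq].
  have [XY|YX] := Ftot X Y FX FY; first exact: (FP Y FY p q (XY _ Xp) Yq).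
  exact: (FP X FX p q Xp (YX _ Yq)).
have [domG|/existsNP[x nx]] := pselect (forall x, exists y, G (x, y)).
  left; have [f fG] := choice domG; exists f => x y fxy.
  by have [_] := PG _ _ (fG x) (fG y); apply.
have [ranG|/existsNP[y ny]] := pselect (forall y, exists x, G (x, y)).
  right; have [f fG] := choice ranG; exists f => a b fab.
  by have [+ _] := PG _ _ (fG a) (fG b); apply.
exfalso; apply: (Gmax (G `|` [set (x, y)])).
  split; first by move=> p Gp; left.
  by move=> /(_ (x, y) (or_intror erefl)) Gxy; apply: nx; exists y.
move=> [a b] [c e] /= [Gab|[-> ->]] [Gce|[-> ->]] //=.
- exact: (PG _ _ Gab Gce).
- by split=> E; [case: nx; exists b; rewrite -E|case: ny; exists a; rewrite -E].
- by split=> E; [case: nx; exists e; rewrite E|case: ny; exists c; rewrite E].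
Qed.

Section InfiniteType.
Context (K : Type) (K_infinite : infinite_set [set: K]).

Definition support (G : set ((K * K) * K)) : set K :=
  [set x | exists y z, G ((x, y), z)].

(** [G] is the graph of an injection [S * S -> S], where [S = support G]. *)
Definition pairing_graph (G : set ((K * K) * K)) : Prop :=
  [/\ forall p z z', G (p, z) -> G (p, z') -> z = z',
      forall p p' z, G (p, z) -> G (p', z) -> p = p',
      forall x y z, G ((x, y), z) -> support G y /\ support G z
    & forall x y, support G x -> support G y -> exists z, G ((x, y), z)].

Lemma support_sub G H : G `<=` H -> support G `<=` support H.
Proof. by move=> GH x [y [z /GH Hxyz]]; exists y, z. Qed.

Lemma pairing_graph_bigcup (F : set (set ((K * K) * K))) :
  F `<=` pairing_graph -> total_on F subset ->
  pairing_graph (\bigcup_(X in F) X).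
Proof.
move=> FP Ftot.
have Fdir X Y : F X -> F Y -> exists Z, [/\ F Z, X `<=` Z & Y `<=` Z].
  move=> FX FY; have [XY|YX] := Ftot X Y FX FY.
    by exists Y; split.
  by exists X; split.
have sup X : F X -> support X `<=` support (\bigcup_(X in F) X).
  by move=> FX; apply: support_sub => p Xp; exists X.
split.
- move=> p z z' [X FX Xz] [Y FY Yz].
  have [Z [FZ XZ YZ]] := Fdir X Y FX FY.
  by have [+ _ _ _] := FP Z FZ; apply; [exact: XZ Xz|exact: YZ Yz].
- move=> p z z' [X FX Xz] [Y FY Yz].
  have [Z [FZ XZ YZ]] := Fdir X Y FX FY.
  by have [_ + _ _] := FP Z FZ; apply; [exact: XZ Xz|exact: YZ Yz].
- move=> x y z [X FX Xz]; have [_ _ /(_ _ _ _ Xz)[Sy Sz] _] := FP X FX.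
  by split; apply: (sup X).
- move=> x y [x' [z [X FX Xz]]] [y' [z' [Y FY Yz]]].
  have [Z [FZ XZ YZ]] := Fdir X Y FX FY.
  have [_ _ _ /(_ x y)] := FP Z FZ.
  case; first by exists x', z; apply: XZ.
    by exists y', z'; apply: YZ.
  by move=> t Zt; exists t, Z.
Qed.

(** Zorn's lemma gives a maximal injection [f : S * S -> S] extending a pairing
    of a countable set.  If [K \ S] contains a copy [h S] of [S], then [f]
    extends to [S `|` h S]: the new pairs are pulled back to [S * S], tagged by
    the positions of their components and sent into [h S], against maximality.
    Otherwise [K \ S] embeds in [S], and hence so does [K]. *)
Lemma square_le : exists f : K * K -> K, injective f.
Proof.
have /infiniteP/card_leTTP[e e_inj] := K_infinite.
pose G0 : set ((K * K) * K) :=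
  [set q | exists m n : nat, q = ((e m, e n), e (choice.pickle (m, n)))].
have supp0 m : support G0 (e m) by exists (e 0), (e (choice.pickle (m, 0))), m, 0.
have G0P : pairing_graph G0.
  split.
  - by move=> _ z z' [m [n [-> ->]]] [m' [n' [/e_inj -> /e_inj -> ->]]].
  - move=> p p' z [m [n [-> ->]]] [m' [n' [-> /e_inj]]].
    by move=> /(pcan_inj choice.pickleK)[-> ->].
  - by move=> x y z [m [n [_ -> ->]]].
  - move=> x y [_ [_ [m [_ [-> _ _]]]]] [_ [_ [n [_ [-> _ _]]]]].
    by exists (e (choice.pickle (m, n))), m, n.
(* [G0] is kept in the union so that the empty chain has an upper bound. *)
have [G1 [G1P G1max]] : exists G, pairing_graph (G0 `|` G) /\
    forall H, G `<` H -> ~ pairing_graph (G0 `|` H).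
  apply: (@Zorn_bigcup _ (fun G => pairing_graph (G0 `|` G))) => F FP Ftot.
  have [[X0 FX0]|/nonemptyPn F0] := pselect (F !=set0); last first.
    by rewrite F0 bigcup_set0 setU0.
  have -> : G0 `|` \bigcup_(X in F) X = \bigcup_(Y in [set G0 `|` X | X in F]) Y.
    apply/seteqP; split=> p.
      move=> [G0p|[X FX Xp]]; first by exists (G0 `|` X0); [exists X0|left].
      by exists (G0 `|` X); [exists X|right].
    by move=> [_ [X FX <-] [|Xp]]; [left|right; exists X].
  apply: pairing_graph_bigcup; first by move=> _ [X FX <-]; apply: FP.
  move=> _ _ [X FX <-] [Y FY <-].
  by have [XY|YX] := Ftot X Y FX FY; [left|right]; apply: setUS.
pose S := support (G0 `|` G1).
have Se m : S (e m) by apply: support_sub (supp0 m) => p; left.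
have [Gfun Ginj Gsup Gtot] := G1P.
have /choice[f fG] (p : K * K) : exists z, S p.1 -> S p.2 -> (G0 `|` G1) (p, z).
  case: p => x y; have [[Sx Sy]|nS] := pselect (S x /\ S y).
    by have [z Gz] := Gtot x y Sx Sy; exists z.
  by exists x => Sx Sy; case: nS.
have fS x y : S x -> S y -> S (f (x, y)).
  by move=> Sx Sy; have [] := Gsup x y _ (fG (x, y) Sx Sy).
have f_inj x y x' y' : S x -> S y -> S x' -> S y' -> f (x, y) = f (x', y') ->
    x = x' /\ y = y'.
  move=> Sx Sy Sx' Sy' E; have G := fG (x, y) Sx Sy; rewrite E in G.
  by have [-> ->] := Ginj _ _ _ G (fG (x', y') Sx' Sy').
have [[j j_inj]|[j j_inj]] := inj_compare {x | S x} {x | ~ S x}.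
- exfalso.
  have /choice[h hP] x : exists z,
      forall Sx : S x, z = proj1_sig (j (exist _ x Sx)).
    have [Sx|nSx] := pselect (S x); last by exists x.
    exists (proj1_sig (j (exist _ x Sx))) => Sx'.
    by rewrite (Prop_irrelevance Sx Sx').
  have hS x : S x -> ~ S (h x).
    by move=> Sx; rewrite (hP x Sx); exact: proj2_sig (j _).
  have h_inj x y : S x -> S y -> h x = h y -> x = y.
    move=> Sx Sy; rewrite (hP x Sx) (hP y Sy) => /eq_sig_hprop E.
    by have /j_inj[] := E (fun x => @Prop_irrelevance _).
  pose S2 x := S x \/ exists2 t, S t & h t = x.
  (* [r] undoes [h] outside [S]; it is injective given membership in [S], which
     [tag] records. *)
  have /choice[r rP] x : exists t, S2 x ->
      [/\ S t, S x -> t = x & ~ S x -> h t = x].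
    have [Sx|nSx] := pselect (S x); first by exists x.
    have [[t St tx]|nN] := pselect (exists2 t, S t & h t = x); first by exists t.
    by exists x => -[].
  pose tag x y := e (choice.pickle (`[< S x >], `[< S y >])).
  pose f2 x y := if pselect (S x /\ S y) then f (x, y)
    else h (f (tag x y, f (r x, r y))).
  pose H : set ((K * K) * K) :=
    [set q | [/\ S2 q.1.1, S2 q.1.2 & q.2 = f2 q.1.1 q.1.2]].
  have rS x : S2 x -> S (r x) by move=> /rP[].
  have tagS x y : S2 x -> S2 y -> S (f (tag x y, f (r x, r y))).
    by move=> /rS Sx /rS Sy; apply: (fS _ _ (Se _)); apply: fS.
  have f2S x y : S2 x -> S2 y -> S2 (f2 x y).
    move=> Sx Sy; rewrite /f2; case: pselect => [[S1x S1y]|nS].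
      by left; apply: fS.
    by right; exists (f (tag x y, f (r x, r y))) => //; apply: tagS.
  have suppH x : support H x <-> S2 x.
    by split=> [[y [z [Sx _ _]]]|Sx]; [exact: Sx|exists x, (f2 x x)].
  have GH : G0 `|` G1 `<=` H.
    move=> [[x y] z] Gxyz; have Sx : S x by exists y, z.
    have [Sy Sz] := Gsup _ _ _ Gxyz; split=> /=; [by left|by left|].
    rewrite /f2; case: pselect => [SS|[]//].
    exact: Gfun Gxyz (fG (x, y) Sx Sy).
  apply: (G1max H).
    split; first by move=> p G1p; apply: GH; right.
    move=> HG; apply: (hS (e 0) (Se _)).
    have S2h : S2 (h (e 0)) by right; exists (e 0).
    by exists (h (e 0)), (f2 (h (e 0)) (h (e 0))); right; apply: HG.
  have -> : G0 `|` H = H.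
    by apply/seteqP; split=> [p [G0p|//]|p Hp]; [apply: GH; left|right].
  split.
  - by move=> p z z' [_ _ /= ->] [_ _ /= ->].
  - move=> [x y] [x' y'] z [/= Sx Sy ->] [/= Sx' Sy'].
    have [rx rxS rxN] := rP x Sx; have [ry ryS ryN] := rP y Sy.
    have [rx' rxS' rxN'] := rP x' Sx'; have [ry' ryS' ryN'] := rP y' Sy'.
    rewrite /f2; case: pselect => [[S1x S1y]|nS];
      case: pselect => [[S1x' S1y']|nS'] /=.
    + by move=> /f_inj[]// -> ->.
    + by move=> E; case: (hS _ (tagS _ _ Sx' Sy')); rewrite -E; apply: fS.
    + by move=> E; case: (hS _ (tagS _ _ Sx Sy)); rewrite E; apply: fS.
    + move=> /(h_inj _ _ (tagS _ _ Sx Sy) (tagS _ _ Sx' Sy')).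
      move=> /(f_inj _ _ _ _ (Se _) (fS _ _ rx ry) (Se _) (fS _ _ rx' ry')).
      move=> [/e_inj/(pcan_inj choice.pickleK)[Ex Ey] /f_inj[]// Erx Ery].
      have {}Ex := asbool_eq_equiv Ex; have {}Ey := asbool_eq_equiv Ey.
      congr (_, _).
        have [S1x|nSx] := pselect (S x); first by rewrite -rxS // Erx rxS' // -Ex.
        by rewrite -rxN // Erx rxN' // -Ex.
      have [S1y|nSy] := pselect (S y); first by rewrite -ryS // Ery ryS' // -Ey.
      by rewrite -ryN // Ery ryN' // -Ey.
  - by move=> x y z [/= Sx Sy ->]; split; apply/suppH => //; apply: f2S.
  - by move=> x y /suppH Sx /suppH Sy; exists (f2 x y).
- pose i x := if pselect (S x) is right nSx
    then f (e 1, proj1_sig (j (exist _ x nSx))) else f (e 0, x).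
  have iS x : S (i x).
    rewrite /i; case: pselect => [Sx|nSx]; apply: fS => //.
    exact: proj2_sig (j _).
  have i_inj : injective i.
    move=> x y; rewrite /i; case: pselect => [Sx|nSx]; case: pselect => [Sy|nSy].
    + by move=> /f_inj[].
    + move=> /f_inj[] //; first exact: proj2_sig (j _).
      by move=> /e_inj.
    + move=> /f_inj[] //; first exact: proj2_sig (j _).
      by move=> /e_inj.
    + move=> /f_inj[] //; [exact: proj2_sig (j _)|exact: proj2_sig (j _)|].
      move=> _ /eq_sig_hprop E.
      by have /j_inj[] := E (fun x => @Prop_irrelevance _).
  exists (fun p => f (i p.1, i p.2)) => -[x y] [x' y'] /=.
  by move=> /f_inj[]// /i_inj -> /i_inj ->.
Qed.

Lemma option_square_le : exists q : option (K * K) -> K, injective q.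
Proof.
have [f f_inj] := square_le.
have /infiniteP/card_leTTP[e e_inj] := K_infinite.
exists (fun o => if o is Some p then f (e 1, f p) else f (e 0, e 0)).
by move=> [p|] [p'|] // /f_inj[]; [move/f_inj->|move/e_inj|move/e_inj].
Qed.

Lemma card_sum_set L1 L2 :
  [set: L1] #<= [set: set K] -> [set: L2] #<= [set: set K] ->
  [set: (L1 + L2)%type] #<= [set: set K].
Proof.
move=> /card_leTTP[f1 f1_inj] /card_leTTP[f2 f2_inj].
have [q q_inj] := option_square_le.
pose k := q None.
pose tl (A : set K) := [set q (Some (x, k)) | x in A].
pose dec (A : set K) := [set x | A (q (Some (x, k)))].
have tlK A : dec (tl A) = A.
  apply/seteqP; split=> x; last by move=> Ax; exists x.
  by move=> [y Ay /q_inj[<-]].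
have tlUK A : dec (k |` tl A) = A.
  apply/seteqP; split=> x; last by move=> Ax; right; exists x.
  by move=> [/q_inj|[y Ay /q_inj[<-]]].
have tlNk A : ~ tl A k by move=> [x _ /q_inj].
apply/card_leTTP; exists (fun c => match c with
  | inl a => tl (f1 a) | inr b => k |` tl (f2 b) end).
move=> [a|b] [a'|b'] E.
- by congr inl; apply: f1_inj; rewrite -[LHS]tlK E tlK.
- by case: (tlNk (f1 a)); rewrite E; left.
- by case: (tlNk (f1 a')); rewrite -E; left.
- by congr inr; apply: f2_inj; rewrite -[LHS]tlUK E tlUK.
Qed.

Lemma card_fun_set I :
  [set: I] #<= [set: set K] -> [set: K -> I] #<= [set: set K].
Proof.
move=> /card_leTTP[phi phi_inj]; have [q q_inj] := square_le.
apply/card_leTTP.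
exists (fun w => [set k | exists x t, phi (w x) t /\ k = q (x, t)]).
have sub (w w' : K -> I) :
    [set k | exists x t, phi (w x) t /\ k = q (x, t)] `<=`
    [set k | exists x t, phi (w' x) t /\ k = q (x, t)] ->
    forall x, phi (w x) `<=` phi (w' x).
  move=> S x t wxt.
  by have [|x' [t' [wxt' /q_inj[-> ->]]]] := S (q (x, t)); [exists x, t|].
move=> w w' E; apply/funext => x; apply: phi_inj.
by apply/seteqP; split; apply: sub; rewrite E.
Qed.

(** Well-founded [K]-branching trees: names for the elements of a structure
    generated from one element by an operation of arity [K]. *)
Inductive code := Leaf | Node of (K -> code).

(** A tree is determined by the set of its nodes, seen as finite sequences over
    [K]; the injection [q] encodes these sequences in [K]. *)
Lemma card_code_set : [set: code] #<= [set: set K].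
Proof.
have [q q_inj] := option_square_le.
pose fix enc (c : code) : set K := match c with
  | Leaf => set0
  | Node h => [set k | k = q None \/
      exists x t, enc (h x) t /\ k = q (Some (x, t))]
  end.
apply/card_leTTP; exists enc.
have none h : enc (Node h) (q None) by left.
elim=> [|h IH] [|h'] // E.
- by have := none h'; rewrite -E.
- by have := none h; rewrite E.
congr Node; apply/funext => x; apply: IH.
have sub (g g' : K -> code) : enc (Node g) `<=` enc (Node g') ->
    enc (g x) `<=` enc (g' x).
  move=> S t gt.
  have [|/q_inj//|[x' [t' [gt' /q_inj[-> ->]]]]] := S (q (Some (x, t))) => //.
  by right; exists x, t.
by apply/seteqP; split; apply: sub; rewrite E.
Qed.

Lemma card_code_fun : [set: K -> code] #<= [set: code].
Proof. by apply/card_leTTP; exists Node => f g []. Qed.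
End InfiniteType.

Lemma strict_well_order I : exists R : I -> I -> Prop,
  (forall a b, [\/ R a b, a = b | R b a]) /\
  forall A : set I, A !=set0 -> exists2 z, A z & forall x, A x -> ~ R x z.
Proof.
have [W woW] := wochoice.well_ordering_principle {classic I}.
have minW (A : set I) : A !=set0 -> exists2 z, A z & forall x, A x -> W z x.
  move=> [a Aa]; have [|z [[zA zmin] _]] := woW [pred x | `[< A x >]].
    by exists a; apply/asboolP.
  exists z; first by have /asboolP := zA.
  by move=> x Ax; apply: zmin; apply/asboolP.
have refl a : W a a.
  by have [|z -> /(_ a erefl)] := minW [set a]; first by exists a.
have anti a b : W a b -> W b a -> a = b.
  move=> ab ba; have [|z [_ zuniq]] := woW [pred x | `[< x = a \/ x = b >]].
    by exists a; apply/asboolP; left.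
  have <- : z = a.
    by apply: zuniq; split; [apply/asboolP; left|move=> x /asboolP[] ->].
  by apply: zuniq; split; [apply/asboolP; right|move=> x /asboolP[] ->].
exists (fun a b => ~~ W b a); split.
- move=> a b; have [ab|nab] := boolP (W a b); last by apply: Or33.
  have [ba|nba] := boolP (W b a); last by apply: Or31.
  by apply: Or32; apply: anti.
- by move=> A /minW[z Az zmin]; exists z => // x /zmin ->.
Qed.

Lemma card_eq_range T U (A : set T) :
  A #= [set: U] -> exists f : U -> T, range f = A.
Proof.
elim/Ppointed: T => T in A *.
  rewrite !emptyE => U0.
  have noU (x : U) : False by have : [set: U] x := Logic.I; rewrite U0.
  exists (fun x => match noU x with end).
  by apply/seteqP; split=> x // [y]; have := noU y.
rewrite card_eq_sym => /card_set_bijP[f [ffun _ fsurj]]; exists f.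
apply/seteqP; split=> [_ [x _ <-]|y /fsurj]; first exact: ffun.
by [].
Qed.

(** * Cuts of a power modulo an ultrafilter *)

Section Cut.
Context (K : Type) (D : set_system K) (UD : UltraFilter D) (T : Type).
Implicit Types (le : rel T) (X : set (K -> T)).

Definition leD le (f g : K -> T) : Prop := D [set i | le (f i) (g i)].

Definition flip le : rel T := fun x y => le y x.

Lemma leD_trans le : transitive le ->
  forall f g h, leD le f g -> leD le g h -> leD le f h.
Proof.
move=> tr f g h fg gh; apply: filterS (filterI fg gh) => i [/=].
exact: tr.
Qed.

Lemma not_leD le f g : ~ leD le f g -> D [set i | ~~ le (f i) (g i)].
Proof.
have [//|+ _] := in_ultra_setVsetC [set i | le (f i) (g i)] UD.
by apply: filterS => i /= /negP.
Qed.

Lemma leD_total le : total le -> forall f g, ~ leD le f g -> leD le g f.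
Proof.
move=> tot f g /not_leD; apply: filterS => i /=.
by have /orP[->|] := tot (f i) (g i).
Qed.

(** Strict inequality is written [~~ le b a], so that reversing the order only
    reverses [le]. *)
Definition saturated_below (M : Type) le : Prop := forall A B : set T,
  A #<= [set: M] -> B #<= [set: M] ->
  (forall a b, A a -> B b -> ~~ le b a) ->
  exists x, (forall a, A a -> ~~ le x a) /\ (forall b, B b -> ~~ le b x).

(** Minimality of [L] is expressed as boundedness of small families, which is
    how the regularity of a cofinality enters the arguments. *)
Definition lower_cofinality le X (L : Type) : Prop :=
  (exists u : L -> K -> T,
     (forall a, X (u a)) /\ forall f, X f -> exists a, leD le f (u a)) /\
  forall (I : Type) (w : I -> K -> T), (forall i, X (w i)) ->
     ~ ([set: L] #<= [set: I]) -> exists f, X f /\ forall i, ~ leD le f (w i).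

(** The left side of the cut is [X], the right side [~` X].  The properties are
    stable under reversal of the order, which exchanges [L1] and [L2]. *)
Record power_cut le X (L1 L2 M : Type) : Prop := PowerCut {
  cut_total : total le;
  cut_trans : transitive le;
  cut_saturated : saturated_below M le;
  cut_closed : forall f g, leD le f g -> X g -> X f;
  cut_lower : lower_cofinality le X L1;
  cut_upper : lower_cofinality (flip le) (~` X) L2;
  cut_leq1 : [set: L1] #<= [set: M];
  cut_leq2 : [set: L2] #<= [set: M] }.

Lemma power_cut_flip le X L1 L2 M :
  power_cut le X L1 L2 M -> power_cut (flip le) (~` X) L2 L1 M.
Proof.
case=> tot tr sat cl lo up l1 l2; split=> //.
- by move=> x y; rewrite /flip orbC.
- by move=> y x z xy yz; apply: tr yz xy.
- move=> A B sA sB AB.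
  have [|x [xB xA]] := sat B A sB sA; last by exists x.
  by move=> b a Bb Aa; apply: AB.
- by move=> f g fg nXg Xf; apply: nXg; apply: cl Xf.
- by rewrite setCK.
Qed.

(** * Approaching a cut through a family *)

Section Family.
Context (I : Type) (s : I -> K -> T).

Definition section (w : K -> I) : K -> T := fun i => s (w i) i.

Definition approached le X (B : K -> set I) : Prop :=
  forall f, X f -> exists w,
    [/\ D [set i | B i (w i)], X (section w) & leD le f (section w)].

Definition separating le X (B : K -> set I) : Prop :=
  forall f g, X f -> ~ X g -> exists w,
    [/\ D [set i | B i (w i)], leD le f (section w) & leD le (section w) g].

Lemma separating_sub le X B B' : (forall i, B i `<=` B' i) ->
  separating le X B -> separating le X B'.
Proof.
move=> BB' sep f g Xf nXg; have [w [Bw fw wg]] := sep f g Xf nXg.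
by exists w; split=> //; apply: filterS Bw => i; apply: BB'.
Qed.

Lemma separating_flip le X B :
  separating (flip le) (~` X) B <-> separating le X B.
Proof.
split=> sep f g.
- by move=> Xf nXg; have [w []] := sep g f nXg (fun nXf => nXf Xf); exists w.
- by move=> nXf /contrapT Xg; have [w []] := sep g f Xg nXf; exists w.
Qed.

Lemma approached_separating le X L1 L2 M B : power_cut le X L1 L2 M ->
  approached le X B -> separating le X B.
Proof.
move=> cut app f g Xf nXg; have [w [Bw Xw fw]] := app f Xf.
exists w; split=> //; apply: (leD_total (cut_total cut)) => gw.
exact/nXg/(cut_closed cut gw).
Qed.

(** This is where saturation enters.  Let [P i] be the set of values of the
    family below [g i], and let [h i] lie between [P i] and those [v b i] that
    exceed [P i], where [v] is coinitial on the right.  Sections on the left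
    take their values in [P i] modulo [D], so [h] is on the right and some [v b]
    is below it.  This [v b i] does not exceed [P i], which gives a value of the
    family between [v b i] and [g i]. *)
Lemma approached_flip le X L1 L2 M B : power_cut le X L1 L2 M ->
  [set: I] #<= [set: M] ->
  approached le X B -> approached (flip le) (~` X) B.
Proof.
move=> cut sI app g nXg.
have [[v [nXv vcof]] _] := cut_upper cut.
pose P i := [set x | exists2 a, B i a & x = s a i /\ ~~ le (g i) (s a i)].
pose G i := [set x | exists2 b, x = v b i & forall p, P i p -> ~~ le (v b i) p].
have /choice[h hP] i : exists x,
    (forall p, P i p -> ~~ le x p) /\ (forall q, G i q -> ~~ le q x).
  apply: (cut_saturated cut); last by move=> p q Pp [b -> /(_ p Pp)].
  - apply: card_le_trans sI; apply: card_le_trans (card_image_le (s ^~ i) _).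
    by apply: subset_card_le => _ [a _ [-> _]]; exists a.
  - apply: card_le_trans (cut_leq2 cut).
    apply: card_le_trans (card_image_le (v ^~ i) _).
    by apply: subset_card_le => _ [b -> _]; exists b.
have nXh : ~ X h.
  move=> Xh; have [w [Bw Xw hw]] := app h Xh.
  have /not_leD gw : ~ leD le g (section w).
    by move=> gw; exact/nXg/(cut_closed cut gw).
  have DQ : D ([set i | B i (w i)] `&` [set i | ~~ le (g i) (section w i)]
      `&` [set i | le (h i) (section w i)]).
    by apply: filterI hw; apply: filterI.
  have [i [[/= Bi gi] hi]] := filter_ex DQ.
  have [hPi _] := hP i; suff /hPi/negP : P i (s (w i) i) by [].
  by exists (w i).
have [b vh] := vcof h nXh.
have DQ : D [set i | exists a,
    [/\ B i a, ~~ le (g i) (s a i) & le (v b i) (s a i)]].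
  apply: filterS vh => i /= vhi; have [_ hG] := hP i.
  apply: contrapT => no; suff /hG/negP : G i (v b i) by [].
  exists b => // _ [a Ba [-> ga]]; apply/negP => va; apply: no.
  by exists a.
have [i0 [a0 _]] := filter_ex DQ.
have /choice[w wP] i : exists a,
    (exists a, [/\ B i a, ~~ le (g i) (s a i) & le (v b i) (s a i)]) ->
    [/\ B i a, ~~ le (g i) (s a i) & le (v b i) (s a i)].
  have [[a aP]|no] := pselect (exists a, [/\ B i a, ~~ le (g i) (s a i)
    & le (v b i) (s a i)]); first by exists a.
  by exists a0 => /no.
exists w; split.
- by apply: filterS DQ => i /wP[].
- move=> Xw; apply: (nXv b); apply: (cut_closed cut) Xw.
  by apply: filterS DQ => i /wP[].
- apply: filterS DQ => i /wP[_ /negbTE gw _]; rewrite /flip /section.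
  by have := cut_total cut (g i) (s (w i) i); rewrite gw.
Qed.

(** If the sections on the left are not cofinal, as [f0] witnesses, then the
    sections separating [f0] from points on the right are on the right, so they
    are coinitial there; now reverse the order. *)
Lemma separating_approached le X L1 L2 M B : power_cut le X L1 L2 M ->
  [set: I] #<= [set: M] ->
  separating le X B -> approached le X B.
Proof.
move=> cut sI sep; apply: contrapT => nlo.
have /existsNP[f0 /not_implyP[Xf0 nof]] := nlo.
apply: nlo; rewrite -[X in approached _ X _]setCK.
apply: (approached_flip (power_cut_flip cut) sI) => g nXg.
have [w [Bw fw wg]] := sep f0 g Xf0 nXg.
by exists w; split=> // Xw; apply: nof; exists w.
Qed.

(** The hypothesis on [L1] and [L2] makes any [L1] points on the right have a
    common lower bound there.  If no section [w1 a] of a family cofinal on the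
    left can serve as [y], this is applied to the points [g a] that refute
    them, and a section below the bound dominates every [w1 a]. *)
Lemma separating_below_lt (R : I -> I -> Prop) le X L1 L2 M B :
  (forall a b, [\/ R a b, a = b | R b a]) ->
  power_cut le X L1 L2 M -> [set: I] #<= [set: M] ->
  ~ ([set: L2] #<= [set: L1]) -> separating le X B ->
  exists y, D [set i | B i (y i)] /\
    separating le X (fun i => B i `&` [set a | R a (y i)]).
Proof.
move=> tri cut sI n21 sep.
have lo := separating_approached cut sI sep.
have up := approached_flip cut sI lo.
have [[u [Xu ucof]] _] := cut_lower cut.
have /choice[w1 w1P] a := lo (u a) (Xu a).
pose below y i := B i `&` [set a | R a (y i)].
have [//|none] := pselect (exists y, D [set i | B i (y i)] /\
    separating le X (below y)).
have /choice[g gP] a : exists g, ~ X g /\ forall w,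
    D [set i | below (w1 a) i (w i)] -> ~ X (section w) ->
    ~ leD le (section w) g.
  apply: contrapT => no; apply: none; exists (w1 a).
  have [Bw1 _ _] := w1P a; split=> //.
  apply/separating_flip; apply: (approached_separating (power_cut_flip cut)).
  move=> g nXg; apply: contrapT => no'; apply: no; exists g.
  split=> // w bw nXw wg.
  by apply: no'; exists w.
have [_ /(_ _ g (fun a => proj1 (gP a)) n21)[g' [nXg' g'P]]] := cut_upper cut.
have [w' [Bw' nXw' w'g']] := up g' nXg'.
(* The predecessors of [w1 a] do not reach below [g a], so [w'] is not one of
   them; nor is it equal to [w1 a], since the two sections lie on different
   sides of the cut. *)
have w1w' a : D [set i | R (w1 a i) (w' i)].
  have [Bw1 Xw1 _] := w1P a.
  have w'g : leD le (section w') (g a).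
    apply: (leD_trans (cut_trans cut) w'g').
    exact: (leD_total (cut_total cut) (g'P a)).
  have [bw|nbw] := in_ultra_setVsetC [set i | below (w1 a) i (w' i)] UD.
    by have [_ /(_ w' bw nXw')] := gP a.
  have [//|nR] := in_ultra_setVsetC [set i | R (w1 a i) (w' i)] UD.
  exfalso; apply: nXw'; apply: (cut_closed cut) Xw1.
  apply: filterS (filterI (filterI nbw nR) Bw') => i [[/= nb nr] Bi].
  rewrite /section; have [//| ->|wr] := tri (w1 a i) (w' i).
    by have := cut_total cut (s (w' i) i) (s (w' i) i); rewrite orbb.
  by case: nb.
apply: contrapT => _; apply: none; exists w'; split=> //.
apply: (approached_separating cut) => f Xf.
have [a fu] := ucof f Xf; have [Bw1 Xw1 uw1] := w1P a.
exists (w1 a); split=> //; last exact: (leD_trans (cut_trans cut) fu uw1).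
exact: filterI Bw1 (w1w' a).
Qed.

(** The descent step.  The hypothesis and the conclusion are invariant under
    reversal of the order, so either of the two cofinalities may be taken as
    the one that does not inject into the other. *)
Lemma separating_below (R : I -> I -> Prop) le X L1 L2 M B :
  (forall a b, [\/ R a b, a = b | R b a]) ->
  power_cut le X L1 L2 M -> [set: I] #<= [set: M] ->
  ~ ([set: L1] #= [set: L2]) -> separating le X B ->
  exists y, D [set i | B i (y i)] /\
    separating le X (fun i => B i `&` [set a | R a (y i)]).
Proof.
move=> tri cut sI n12 sep.
have [l21|n21] := pselect ([set: L2] #<= [set: L1]); last first.
  exact: separating_below_lt tri cut sI n21 sep.
have n12' : ~ ([set: L1] #<= [set: L2]).
  by move=> l12; apply: n12; rewrite card_eq_le l12 l21.
have [y [By sepy]] := separating_below_lt tri (power_cut_flip cut) sI n12'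
  ((separating_flip _ _ _).2 sep).
by exists y; split=> //; apply/separating_flip.
Qed.

End Family.
End Cut.

(** * Termination of the descent *)

Section Termination.
Context (K : Type) (D : set_system K) (UD : UltraFilter D) (T : Type).
Context (le : rel T) (X : set (K -> T)) (L1 L2 M : Type).
Hypothesis cut : power_cut D le X L1 L2 M.

Lemma approached_full u : (forall f, X f -> exists a, leD D le f (u a)) ->
  (forall a : L1, X (u a)) -> approached D u le X (fun _ => setT).
Proof.
move=> ucof Xu f /ucof[a fu]; exists (fun _ => a).
by split; [apply: filterS filterT => i _|exact: Xu|].
Qed.

(** The descent starts from all indices of a cofinal family on the left, and is
    then iterated on initial segments of [R]; intersections with the preceding
    segment may be dropped, as enlarging [B] preserves separation. *)
Lemma descent_step u (R : L1 -> L1 -> Prop) :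
  (forall a b, [\/ R a b, a = b | R b a]) -> ~ ([set: L1] #= [set: L2]) ->
  (forall a, X (u a)) -> (forall f, X f -> exists a, leD D le f (u a)) ->
  let sep y := separating D u le X (fun i => [set a | R a (y i)]) in
  (exists y0, sep y0) /\
  exists step, forall y, sep y -> D [set i | R (step y i) (y i)] /\ sep (step y).
Proof.
move=> Rtri n12 Xu ucof sep.
have next B : separating D u le X B ->
    exists y, D [set i | B i (y i)] /\ sep y.
  move=> sepB.
  have [y [By sepy]] := separating_below UD Rtri cut (cut_leq1 cut) n12 sepB.
  by exists y; split=> //; apply: separating_sub sepy => i a [].
split.
  have [|y0 [_ sepy0]] := next (fun=> setT); last by exists y0.
  exact: (approached_separating UD cut (approached_full ucof Xu)).
have /choice[step stepP] (y : K -> L1) : exists y',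
    sep y -> D [set i | R (y' i) (y i)] /\ sep y'.
  have [sepy|nsep] := pselect (sep y); last by exists y.
  by have [y' [yy' sepy']] := next _ sepy; exists y'.
by exists step.
Qed.

(** Countable completeness turns a descent modulo [D] into one that is strict
    at every step on a common coordinate. *)
Lemma power_cut_complete : aleph1_complete D -> [set: L1] #= [set: L2].
Proof.
move=> Dcompl; apply: contrapT => n12.
have [[u [Xu ucof]] _] := cut_lower cut.
have [R [Rtri Rmin]] := strict_well_order L1.
have [[y0 sepy0] [step stepP]] := descent_step Rtri n12 Xu ucof.
pose y n := iter n step y0.
have sepy n : separating D u le X (fun i => [set a | R a (y n i)]).
  by elim: n => [|n /stepP[]].
pose A n := [set i | R (y n.+1 i) (y n i)].
have DA n : D (A n) by have [] := stepP _ (sepy n).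
have : D (\bigcap_(B in range A) B).
  apply: Dcompl; last by move=> _ [n _ <-].
  exact: card_image_le.
move=> /filter_ex[i iA].
have [|_ [n _ <-] nmin] := Rmin (range (fun n => y n i)).
  by exists (y 0 i), 0.
apply: (nmin (y n.+1 i)); first by exists n.+1.
by apply: (iA (A n)); exists n.
Qed.

(** A function that cannot be lowered is found among the diagonals of the
    functions named by codes, of which there are at most [2^K]: separation by
    any of them is tested on a single pair [f], [g], so it becomes a condition
    on coordinates that can be minimised separately on each of them. *)
Lemma power_cut_large : infinite_set [set: K] ->
  ~ ([set: L1] #<= [set: set K]) -> ~ ([set: L2] #<= [set: set K]) ->
  [set: L1] #= [set: L2].
Proof.
move=> Kinf n1 n2; apply: contrapT => n12.
have [[u [Xu ucof]] lomin] := cut_lower cut.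
have [[v [nXv vcof]] upmin] := cut_upper cut.
have [R [Rtri Rmin]] := strict_well_order L1.
pose below y (i : K) := [set a | R a (y i)].
have [[y0 sepy0] [step stepP]] := descent_step Rtri n12 Xu ucof.
pose fix eval (c : code K) : K -> L1 := match c with
  | Leaf => y0
  | Node h => step (fun i => eval (h i) i)
  end.
pose diag (h : K -> code K) i := eval (h i) i.
have ncode L :
    ~ ([set: L] #<= [set: set K]) -> ~ ([set: L] #<= [set: K -> code K]).
  move=> nL Lc; apply: nL; apply: card_le_trans Lc _.
  exact: card_le_trans (card_code_fun K) (card_code_set Kinf).
have inh L : ~ ([set: L] #<= [set: set K]) -> exists a : L, True.
  move=> nL; apply: contrapT => noa; apply: nL; apply/card_leTTP.
  by exists (fun=> set0) => a; case: noa; exists a.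
have [a0 _] := inh _ n1; have [b0 _] := inh _ n2.
pose between h f g := exists w, [/\ D [set i | below (diag h) i (w i)],
  leD D le f (section u w) & leD D le (section u w) g].
(* [F h] refutes separation by [diag h] whenever it fails. *)
have /choice[F FP] h : exists p : (K -> T) * (K -> T), [/\ X p.1, ~ X p.2 &
    between h p.1 p.2 -> separating D u le X (below (diag h))].
  have [seph|nseph] := pselect (separating D u le X (below (diag h))).
    by exists (u a0, v b0); split=> //; [exact: Xu|exact: nXv].
  apply: contrapT => noF; apply: nseph => f g Xf nXg; apply: contrapT => nw.
  by apply: noF; exists (f, g).
have XF h : X (F h).1 by have [] := FP h.
have nXF h : (~` X) (F h).2 by have [] := FP h.
(* [f] and [g] lie closer to the cut than every [F h]. *)
have [f [Xf fF]] := lomin _ (fun h => (F h).1) XF (ncode _ n1).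
have [g [nXg gF]] := upmin _ (fun h => (F h).2) nXF (ncode _ n2).
have betweenP h : between h f g -> separating D u le X (below (diag h)).
  move=> [w [Bw fw wg]]; have [_ _] := FP h; apply; exists w; split=> //.
    apply: (leD_trans UD (cut_trans cut) _ fw).
    exact: (leD_total UD (cut_total cut) (fF h)).
  apply: (leD_trans UD (cut_trans cut) wg).
  exact: (leD_total UD (cut_total cut) (gF h)).
pose good i c :=
  exists a, [/\ R a (eval c i), le (f i) (u a i) & le (u a i) (g i)].
have /choice[h hP] i : exists c, (exists c', good i c') ->
    good i c /\ forall c', good i c' -> ~ R (eval c' i) (eval c i).
  have [[c' gc']|no] := pselect (exists c', good i c'); last by exists (Leaf K).
  have [|_ [c gc <-] cmin] := Rmin [set eval c i | c in good i].
    by exists (eval c' i), c'.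
  by exists c => _; split=> // d gd; apply: cmin; exists d.
have goodP c : separating D u le X (below (eval c)) -> D [set i | good i c].
  move=> sepc; have [w [Bw fw wg]] := sepc f g Xf nXg.
  by apply: filterS (filterI (filterI Bw fw) wg) => i [[Bi fi] gi]; exists (w i).
have seph : separating D u le X (below (diag h)).
  have Dh : D [set i | good i (h i)].
    apply: filterS (goodP (Leaf K) sepy0) => i gi.
    by have [|//] := hP i; exists (Leaf K).
  have /choice[w wP] i : exists a, good i (h i) ->
      [/\ R a (diag h i), le (f i) (u a i) & le (u a i) (g i)].
    have [[a aP]|no] := pselect (good i (h i)); first by exists a.
    by exists a0.
  by apply: betweenP; exists w; split; apply: filterS Dh => i /wP[].
(* The step below [diag h] has itself the code [Node h], which contradicts the
   minimality of [h i]. *)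
have [lt_step sep_step] := stepP _ seph.
have DN : D [set i | good i (Node h)] by apply: goodP.
have [i [iR iN]] := filter_ex (filterI lt_step DN).
have [|_ /(_ (Node h) iN)] := hP i; first by exists (Node h).
exact.
Qed.

(** There are at most [2^K] sections of a family of size at most [2^K].  Those
    on the right of the cut are coinitial there, so their number is at least
    [L2]. *)
Lemma power_cut_small_side : infinite_set [set: K] ->
  [set: L1] #<= [set: set K] -> [set: L2] #<= [set: set K].
Proof.
move=> Kinf l1; apply: contrapT => n2.
have [[u [Xu ucof]] _] := cut_lower cut.
have [[v [nXv vcof]] upmin] := cut_upper cut.
have [b0 _] : exists b : L2, True.
  apply: contrapT => noa; apply: n2; apply/card_leTTP.
  by exists (fun=> set0) => a; case: noa; exists a.
pose w0 (w : K -> L1) := if pselect (X (section u w)) then v b0 else section u w.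
have w0X w : (~` X) (w0 w) by rewrite /w0; case: pselect => // p; exact: nXv.
have [|g [nXg gP]] := upmin _ w0 w0X.
  by move=> l2; apply/n2/(card_le_trans l2)/card_fun_set.
have [w [_ nXw wg]] :=
  approached_flip UD cut (cut_leq1 cut) (approached_full ucof Xu) nXg.
by apply: (gP w); rewrite /w0; case: pselect.
Qed.
End Termination.

(** * Cuts of the ultrapower *)

Section Ultrapower.
Local Open Scope quotient_scope.
Context (K : Type) (D : set_system K) (UD : UltraFilter D).
Context (d : Order.disp_t) (J : orderType d).

Local Notation class := (\pi_(ultrapower UD J)).

(** Stated for any relation [r] induced by [le], so as to apply to both sides
    of a cut: [<=] for the left side and [>=] for the right one. *)
Lemma has_cofinality_lower (le : rel J) (r : rel (ultrapower UD J)) A L :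
  (forall f g, r (class f) (class g) <-> leD D le f g) ->
  has_cofinality r A L -> lower_cofinality D le [set f | A (class f)] L.
Proof.
move=> rP [[C [CA Ccof] /card_eq_range[u uC]] Cmin]; split.
  have uCx a : C (u a) by rewrite -uC; exists a.
  exists (fun a => repr (u a)); split=> [a|f Af].
    by rewrite /= reprK; apply: CA.
  have [_ /[1!(esym uC)][[a _ <-]] fa] := Ccof _ Af; exists a.
  by apply/rP; rewrite reprK.
move=> I w wA nLI; apply: contrapT => nof; apply: nLI.
apply: card_le_trans (card_image_le (fun i => class (w i)) setT).
apply: Cmin; split=> [_ [i _ <-]|x Ax]; first exact: wA.
apply: contrapT => nox; apply: nof; exists (repr x); split=> [|i xi].
  by rewrite /= reprK.
apply: nox; exists (class (w i)); first by exists i.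
by rewrite -[x]reprK; apply/rP.
Qed.

Lemma cut_spectrum_power_cut (L1 L2 mu : Type) (J1 J2 : set (ultrapower UD J)) :
  is_succ_card mu (L1 + L2)%type -> saturated mu J ->
  is_cut J1 J2 -> cut_cofinality J1 J2 L1 L2 ->
  power_cut D (<=%O : rel J) [set f | J1 (class f)] L1 L2 (L1 + L2).
Proof.
move=> [[leMmu nmuM] _] sat [J1cl ->] [cof1 cof2].
have piP f g : (class f <= class g)%O <->
    leD D (<=%O : rel J) f g by apply: ultrapower_leP.
split.
- exact: le_total.
- exact: le_trans.
- have lt_mu (A : set J) : A #<= [set: (L1 + L2)%type] -> card_lt A [set: mu].
    move=> leA; split; first exact: card_le_trans leA leMmu.
    by move=> muA; apply/nmuM/(card_le_trans muA).
  move=> A B /lt_mu sA /lt_mu sB AB.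
  have [|x [Ax xB]] := sat A B sA sB; first by move=> a b Aa Bb; rewrite ltNge AB.
  by exists x; split=> [a /Ax|b /xB]; rewrite ltNge.
- by move=> f g fg J1g; apply: J1cl J1g _; apply/piP.
- exact: has_cofinality_lower piP cof1.
- by apply: has_cofinality_lower cof2 => f g; apply: piP.
- by apply/card_leTTP; exists inl => x y [].
- by apply/card_leTTP; exists inr => x y [].
Qed.
End Ultrapower.

(* [set K] is the power set of [K], of cardinality 2 ^ |K|. *)
Theorem theorem1p2 (K : Type) (K_infinite : infinite_set [set: K]) :
  (forall (D : set_system K) (UD : UltraFilter D),
     uniform_filter D -> aleph1_complete D ->
     forall lambda1 lambda2 : Type,
       cut_spectrum UD lambda1 lambda2 ->
       [set: lambda1] #= [set: lambda2]) /\
  (forall (D : set_system K) (UD : UltraFilter D),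
     uniform_filter D ->
     forall lambda1 lambda2 : Type,
       cut_spectrum_above (set K) UD lambda1 lambda2 ->
       [set: lambda1] #= [set: lambda2]).
Proof.
split=> D UD _.
  move=> Dcompl L1 L2 [_ _ [mu [d [J [succ_mu _ sat [J1 [J2 [isc cof]]]]]]]].
  have cut := cut_spectrum_power_cut succ_mu sat isc cof.
  exact: (power_cut_complete UD cut Dcompl).
move=> L1 L2 [[_ _ [mu [d [J [succ_mu _ sat [J1 [J2 [isc cof]]]]]]]] [_ nle]].
have cut := cut_spectrum_power_cut succ_mu sat isc cof.
(* As [2^K + 2^K = 2^K], one of the two cofinalities exceeds [2^K], and then so
   does the other. *)
have sum_le := card_sum_set K_infinite.
apply: (power_cut_large UD cut K_infinite) => [l1|l2]; apply/nle/sum_le => //.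
  exact: (power_cut_small_side UD cut K_infinite l1).
exact: (power_cut_small_side UD (power_cut_flip cut) K_infinite l2).
Qed.
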